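(* Let $\theta^\infty_1,\theta^\infty_2,\theta^\infty_3\in\mathbb{C}$ with $\theta^\infty_1+\theta^\infty_2+\theta^\infty_3=0$. Let $q_1,p_1,q_2,p_2,u,v$ be holomorphic functions of $(t_1,t_2)$ on a domain of $\{t_1\neq t_2\}\subset\mathbb{C}^2$, with $u,v\neq0$. Put $G=\mathrm{diag}(1,u,v)$, $E_2=\mathrm{diag}(0,1,0)$, $E_3=\mathrm{diag}(0,0,1)$, $$\hat A^{(-3)}=\mathrm{diag}(0,-1,-1),\quad \hat A^{(-2)}=\begin{pmatrix}0&-1&-1\\ -p_1&0&0\\ -p_2&0&0\end{pmatrix},\quad \hat A^{(-1)}=\begin{pmatrix}-p_1-p_2&-q_1&-q_2\\ p_1q_1-\theta^\infty_2&p_1-t_1&p_1\\ p_2q_2-\theta^\infty_3&p_2&p_2-t_2\end{pmatrix},$$ and, with $X=p_1(q_1-q_2)-\theta^\infty_2$ and $W=p_2(q_2-q_1)-\theta^\infty_3$, $$\hat B_1=\begin{pmatrix}0&-1&0\\ -p_1&-\frac{W}{t_1-t_2}+q_1&\frac{X}{t_1-t_2}\\ 0&\frac{W}{t_1-t_2}&-\frac{X}{t_1-t_2}\end{pmatrix},\qquad \hat B_2=\begin{pmatrix}0&0&-1\\ 0&-\frac{W}{t_2-t_1}&\frac{X}{t_2-t_1}\\ -p_2&\frac{W}{t_2-t_1}&-\frac{X}{t_2-t_1}+q_2\end{pmatrix}.$$ Consider the linear systems $\frac{\partial Y}{\partial x}=AY$, $\frac{\partial Y}{\partial t_i}=B^{(i)}Y$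 $(i=1,2)$ with $$A=G^{-1}\left(\hat A^{(-3)}x^2+\hat A^{(-2)}x+\hat A^{(-1)}\right)G,\quad B^{(1)}=-E_2x+G^{-1}\hat B_1G,\quad B^{(2)}=-E_3x+G^{-1}\hat B_2G .$$ Then the compatibility conditions $\partial_{t_i}A-\partial_xB^{(i)}+[A,B^{(i)}]=O$ for $i=1,2$ (for all $x$) are equivalent to the Hamiltonian system $$\frac{\partial q_j}{\partial t_i}=\frac{\partial H_{t_i}}{\partial p_j},\qquad \frac{\partial p_j}{\partial t_i}=-\frac{\partial H_{t_i}}{\partial q_j}\qquad(i,j=1,2),$$ $$H_{t_1}=H_{\mathrm{II}}(-\theta^\infty_2;t_1;q_1,p_1)+p_1p_2+\frac1{t_1-t_2}(p_1(q_1-q_2)-\theta^\infty_2)(p_2(q_2-q_1)-\theta^\infty_3),$$ $$H_{t_2}=H_{\mathrm{II}}(-\theta^\infty_3;t_2;q_2,p_2)+p_1p_2+\frac1{t_2-t_1}(p_1(q_1-q_2)-\theta^\infty_2)(p_2(q_2-q_1)-\theta^\infty_3),$$ together with $\frac{\partial u}{\partial t_i}=\frac{\partial v}{\partial t_i}=0$ for $i=1,2$.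
   Context: $H_{\mathrm{II}}(\alpha;t;q,p)=p^2-(q^2+t)p-\alpha q$ is the Hamiltonian of the second Painlevé equation. The Hamiltonians are those of the degenerate Garnier system $H_{\mathrm{Gar}}^{\frac52+1+1}$, here attached to an unramified rank-three linear system with a single irregular singularity at $x=\infty$ of spectral type $(((1)(1)))(((1)))$. *)

(* Defs.v *)
(* Mathematical Components and MathComp-Analysis; the complex numbers are
   [R[i]] with [R : realType]. *)
From mathcomp Require Import all_boot all_order all_algebra.
From mathcomp Require Export complex.
From mathcomp Require Import all_classical all_reals all_analysis.
Set Implicit Arguments.
Unset Strict Implicit.
Unset Printing Implicit Defensive.
Import Order.TTheory GRing.Theory Num.Theory.
Import numFieldNormedType.Exports.
Local Open Scope complex_scope.
Local Open Scope ring_scope.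
Local Open Scope classical_set_scope.

(* [R[i]^o] is [R[i]] seen as a normed space over itself, so that [derive],
   [derive1] and [differentiable] below are taken over the complex scalars. *)
Notation CC R := (R[i]^o) (only parsing).
Notation CC2 R := (R[i]^o * R[i]^o)%type (only parsing).

Section ComplexAnalysis.
Context {R : realType}.

Definition domain (D : set (CC2 R)) : Prop :=
  [/\ open D, connected D & D !=set0].

Definition holomorphic_on (D : set (CC2 R)) (f : CC2 R -> CC R) : Prop :=
  forall t, D t -> differentiable f t.

Definition partial1 {V : normedModType R[i]} (f : CC2 R -> V) (t : CC2 R) : V :=
  'D_((1, 0) : CC2 R) f t.

Definition partial2 {V : normedModType R[i]} (f : CC2 R -> V) (t : CC2 R) : V :=
  'D_((0, 1) : CC2 R) f t.

End ComplexAnalysis.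

Section LaxMatrices.
Context {F : fieldType}.

Definition mat3 (a b c d e f g h k : F) : 'M[F]_3 :=
  \matrix_(i, j) nth 0 (nth [::] [:: [:: a; b; c];
                                     [:: d; e; f];
                                     [:: g; h; k]] i) j.

Definition diag3 (a b c : F) : 'M[F]_3 :=
  mat3 a 0 0
       0 b 0
       0 0 c.

Definition liebr (M N : 'M[F]_3) : 'M[F]_3 := M *m N - N *m M.

Definition Ahat3 : 'M[F]_3 := diag3 0 (-1) (-1).

Definition Ahat2 (p1 p2 : F) : 'M[F]_3 :=
  mat3 0     (-1) (-1)
       (-p1) 0    0
       (-p2) 0    0.

Definition Ahat1 (theta2 theta3 q1 p1 q2 p2 t1 t2 : F) : 'M[F]_3 :=
  mat3 (- p1 - p2)         (- q1)    (- q2)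
       (p1 * q1 - theta2)  (p1 - t1) p1
       (p2 * q2 - theta3)  p2        (p2 - t2).

Definition Xaux (theta2 q1 p1 q2 : F) : F := p1 * (q1 - q2) - theta2.
Definition Waux (theta3 q1 q2 p2 : F) : F := p2 * (q2 - q1) - theta3.

Definition Bhat1 (theta2 theta3 q1 p1 q2 p2 t1 t2 : F) : 'M[F]_3 :=
  let X := Xaux theta2 q1 p1 q2 in
  let W := Waux theta3 q1 q2 p2 in
  mat3 0      (-1)                     0
       (- p1) (- (W / (t1 - t2)) + q1) (X / (t1 - t2))
       0      (W / (t1 - t2))          (- (X / (t1 - t2))).

Definition Bhat2 (theta2 theta3 q1 p1 q2 p2 t1 t2 : F) : 'M[F]_3 :=
  let X := Xaux theta2 q1 p1 q2 in
  let W := Waux theta3 q1 q2 p2 in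
  mat3 0      0                     (-1)
       0      (- (W / (t2 - t1)))   (X / (t2 - t1))
       (- p2) (W / (t2 - t1))       (- (X / (t2 - t1)) + q2).

Definition Gmat (u v : F) : 'M[F]_3 := diag3 1 u v.

Definition gauge (u v : F) (M : 'M[F]_3) : 'M[F]_3 :=
  invmx (Gmat u v) *m M *m Gmat u v.

Definition Amat (theta2 theta3 q1 p1 q2 p2 u v t1 t2 x : F) : 'M[F]_3 :=
  gauge u v (x ^+ 2 *: Ahat3 + x *: Ahat2 p1 p2
             + Ahat1 theta2 theta3 q1 p1 q2 p2 t1 t2).

Definition B1mat (theta2 theta3 q1 p1 q2 p2 u v t1 t2 x : F) : 'M[F]_3 :=
  - (x *: diag3 0 1 0) + gauge u v (Bhat1 theta2 theta3 q1 p1 q2 p2 t1 t2).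

Definition B2mat (theta2 theta3 q1 p1 q2 p2 u v t1 t2 x : F) : 'M[F]_3 :=
  - (x *: diag3 0 0 1) + gauge u v (Bhat2 theta2 theta3 q1 p1 q2 p2 t1 t2).

Definition HII (alpha t q p : F) : F := p ^+ 2 - (q ^+ 2 + t) * p - alpha * q.

Definition Ham1 (theta2 theta3 t1 t2 q1 p1 q2 p2 : F) : F :=
  HII (- theta2) t1 q1 p1 + p1 * p2
  + (t1 - t2)^-1 * (p1 * (q1 - q2) - theta2) * (p2 * (q2 - q1) - theta3).

Definition Ham2 (theta2 theta3 t1 t2 q1 p1 q2 p2 : F) : F :=
  HII (- theta3) t2 q2 p2 + p1 * p2
  + (t2 - t1)^-1 * (p1 * (q1 - q2) - theta2) * (p2 * (q2 - q1) - theta3).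

End LaxMatrices.

Section Systems.
Context {R : realType}.

(* Hamilton's equations at [t] for one time variable: [d] is the partial
   derivative in that variable ([partial1] or [partial2]) and [H q1 p1 q2 p2]
   the Hamiltonian with the times frozen at [t]. *)
Definition hamilton_at (d : (CC2 R -> CC R) -> CC2 R -> CC R)
    (H : CC R -> CC R -> CC R -> CC R -> CC R)
    (q1 p1 q2 p2 : CC2 R -> CC R) (t : CC2 R) : Prop :=
  [/\ d q1 t = derive1 (fun p : CC R => H (q1 t) p (q2 t) (p2 t)) (p1 t),
      d q2 t = derive1 (fun p : CC R => H (q1 t) (p1 t) (q2 t) p) (p2 t),
      d p1 t = - derive1 (fun q : CC R => H q (p1 t) (q2 t) (p2 t)) (q1 t) &
      d p2 t = - derive1 (fun q : CC R => H (q1 t) (p1 t) q (p2 t)) (q2 t)].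

End Systems.

(* Main.v *)
Require Import Defs.
From mathcomp Require Import all_boot all_order all_algebra.
From mathcomp Require Import all_classical all_reals all_analysis.
From mathcomp Require Import ring.
Set Implicit Arguments.
Unset Strict Implicit.
Unset Printing Implicit Defensive.
Import GRing.Theory numFieldNormedType.Exports.
Local Open Scope complex_scope.
Local Open Scope ring_scope.
Local Open Scope classical_set_scope.

(** The time variables are treated together: a time direction is a vector
[(e1, e2)] equal to [(1, 0)] or [(0, 1)], and with [c = (e1 - e2) / (t1 - t2)]
both matrices [B] and both Hamiltonians are instances of one formula in
[e1, e2, c] ([Bhat], [Ham]).

Let [d] be the derivative in the direction [(e1, e2)], [E = diag (0, e1, e2)]
and [L = diag (0, du / u, dv / v) = dG G^-1].  Since [A = G^-1 Ahat G] and [G]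
commutes with [E], conjugating the zero-curvature equation by [G] turns it into
  [dAhat + [Ahat, L] + [Ahat, Bhat - x E] + E = 0]   ([zero_curvature_gauge]).
The explicit occurrence of [t1, t2] on the diagonal of [Ahat] contributes [- E]
to [dAhat], which cancels the term [E] coming from the derivative of [B] in [x];
what remains of [dAhat] is linear in [dq1, dp1, dq2, dp2] ([Ahat_tangent]).

The left-hand side is thus affine in [(dq1, dp1, dq2, dp2, du / u, dv / v)].
The Hamiltonian vector field with [du = dv = 0] is one zero of it, by a
polynomial identity ([zero_curvature_Hamiltonian_flow]).  Its linear part
[Ahat_tangent + [Ahat, L]], taken for all [x], is injective
([Ahat_gauge_tangent_inj]).  Hence that zero is the only one, which is the
equivalence, pointwise in [t] and separately in each time direction. *)

(** * Three-by-three matrices and the diagonal gauge *)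

Lemma ord3_ind (P : 'I_3 -> Prop) : P 0 -> P 1 -> P 2%:R -> forall i, P i.
Proof.
move=> P0 P1 P2 [[|[|[|//]]] i3].
- by rewrite (_ : Ordinal _ = 0) //; apply: val_inj.
- by rewrite (_ : Ordinal _ = 1) //; apply: val_inj.
- by rewrite (_ : Ordinal _ = 2%:R) //; apply: val_inj.
Qed.

Lemma sum_ord3 {V : nmodType} (f : 'I_3 -> V) : \sum_i f i = f 0 + f 1 + f 2%:R.
Proof.
rewrite !big_ord_recl big_ord0 addr0 addrA.
by congr (f _ + f _ + f _); apply: val_inj.
Qed.

Section Gauge.
Context {F : fieldType}.
Implicit Types (u v : F) (M N : 'M[F]_3).

(** The diagonal of [Gmat u v]; the default [1] is never reached. *)
Definition gauge_weight u v (i : 'I_3) : F := nth 1 [:: 1; u; v] i.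

Lemma gauge_weight_neq0 u v i : u != 0 -> v != 0 -> gauge_weight u v i != 0.
Proof. by move=> u0 v0; elim/ord3_ind: i; rewrite //= oner_neq0. Qed.

Lemma mulVGmat u v : u != 0 -> v != 0 -> Gmat u^-1 v^-1 *m Gmat u v = 1%:M.
Proof.
move=> u0 v0; apply/matrixP; apply: ord3_ind; apply: ord3_ind;
  by rewrite !(mxE, sum_ord3) /= ?(mulr0, mul0r, addr0, add0r, mulr1, mulVf).
Qed.

Lemma Gmat_unit u v : u != 0 -> v != 0 -> Gmat u v \in unitmx.
Proof. by move=> u0 v0; have [] := mulmx1_unit (mulVGmat u0 v0). Qed.

Lemma invmx_Gmat u v : u != 0 -> v != 0 -> invmx (Gmat u v) = Gmat u^-1 v^-1.
Proof.
move=> u0 v0; rewrite -[RHS](mulmxK (Gmat_unit u0 v0)).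
by rewrite mulVGmat // mul1mx.
Qed.

Lemma gaugeE u v M i j : u != 0 -> v != 0 ->
  gauge u v M i j = (gauge_weight u v i)^-1 * M i j * gauge_weight u v j.
Proof.
move=> u0 v0; rewrite /gauge invmx_Gmat //; elim/ord3_ind: i; elim/ord3_ind: j;
  rewrite !(mxE, sum_ord3) /= ?(mulr0, mul0r, addr0, add0r, mulr1, mul1r, invr1);
  reflexivity.
Qed.

Lemma gaugeD u v M N : gauge u v (M + N) = gauge u v M + gauge u v N.
Proof. by rewrite /gauge mulmxDr mulmxDl. Qed.

Lemma gauge_diag3 u v a b c : u != 0 -> v != 0 ->
  gauge u v (diag3 a b c) = diag3 a b c.
Proof.
move=> u0 v0; apply/matrixP => i j; rewrite gaugeE //.
elim/ord3_ind: i; elim/ord3_ind: j; rewrite /gauge_weight !mxE /=; field;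
  by rewrite ?oner_neq0 ?u0 ?v0.
Qed.

(** Conjugation by [G] is an algebra automorphism. *)
Lemma gauge_liebr u v M N : u != 0 -> v != 0 ->
  gauge u v (liebr M N) = liebr (gauge u v M) (gauge u v N).
Proof.
move=> u0 v0; rewrite /gauge /liebr mulmxBr mulmxBl !mulmxA.
by rewrite !(mulmxKV, mulmxK) ?Gmat_unit.
Qed.

Lemma gauge_eq0 u v M : u != 0 -> v != 0 -> gauge u v M = 0 <-> M = 0.
Proof.
move=> u0 v0; split=> [|->]; last by rewrite /gauge mulmx0 mul0mx.
move=> gM0; apply/matrixP => i j; apply/eqP.
move/matrixP: gM0 => /(_ i j)/eqP; rewrite gaugeE // !mxE !mulf_eq0 invr_eq0.
by rewrite !(negPf (gauge_weight_neq0 _ _ _)) // orbF.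
Qed.

End Gauge.

(** * Directional derivatives *)

Section Derive.
Context {K : numFieldType} {V : normedModType K}.

Lemma is_derive_scale_cst {W : normedModType K} (f : V -> K) (t w : V) (df : K)
    (c : W) :
  is_derive t w f df -> is_derive t w (fun s => f s *: c) (df *: c).
Proof.
move=> [/cvg_ex[l fl] fE].
have dfE : l = df by rewrite -fE; apply/esym/cvg_lim.
have lim : (fun h => h^-1 *: (((fun s => f s *: c) \o shift t) (h *: w) - f t *: c))
    @ 0^' --> df *: c.
  under eq_fun => h do rewrite /= -scalerBl scalerA.
  by rewrite -dfE; apply: cvgZr_tmp fl.
by apply: DeriveDef; [apply/cvg_ex; exists (df *: c) | apply: cvg_lim lim].
Qed.

(** A matrix is the combination of the constant matrices [delta_mx i j] with its
entries as coefficients. *)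
Lemma is_derive_mx {m n} (M : V -> 'M[K]_(m, n)) (t w : V) (dM : 'M[K]_(m, n)) :
  (forall i j, is_derive t w (fun s => M s i j) (dM i j)) ->
  is_derive t w M dM.
Proof.
move=> H.
rewrite [dM]matrix_sum_delta.
have -> : M = \sum_(i < m) \sum_(j < n) (fun s => M s i j *: delta_mx i j).
  apply/funext => s; rewrite [LHS]matrix_sum_delta fct_sumE.
  by apply: eq_bigr => i _; rewrite fct_sumE.
apply: is_derive_sum => i; apply: is_derive_sum => j.
exact: is_derive_scale_cst.
Qed.

Lemma is_derive_inv (f : V -> K) (t w : V) (df : K) : f t != 0 ->
  is_derive t w f df -> is_derive t w (fun s => (f s)^-1) (- (df / f t ^+ 2)).
Proof.
move=> f0 [fd <-]; apply: DeriveDef; first exact: derivableV.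
by rewrite deriveV // /GRing.scale /= mulrC mulrN.
Qed.

(** [d (G^-1 M G) = G^-1 (dM + [M, dG G^-1]) G], read entrywise: the entry [i, j]
of the conjugated matrix is [M i j * g_j / g_i], and its logarithmic derivative
gains [dg_j / g_j - dg_i / g_i].  The entries of [gauge] have this form only where
[u] and [v] do not vanish, so they must not vanish near [t]. *)
Lemma is_derive_gauge (u v : V -> K) (M : V -> 'M[K]_3) (t w : V) (du dv : K)
    (dM : 'M[K]_3) :
    (\forall s \near t, u s != 0) -> (\forall s \near t, v s != 0) ->
    is_derive t w u du -> is_derive t w v dv ->
    (forall i j, is_derive t w (fun s => M s i j) (dM i j)) ->
  is_derive t w (fun s => gauge (u s) (v s) (M s))
    (gauge (u t) (v t) (dM + liebr (M t) (diag3 0 (du / u t) (dv / v t)))).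
Proof.
move=> u0 v0 ud vd Md.
have ut0 := nbhs_singleton u0; have vt0 := nbhs_singleton v0.
apply: is_derive_mx => i j; rewrite gaugeE //.
pose dg := fun i : 'I_3 => nth 0 [:: 0; du; dv] i.
have gd k : is_derive t w (fun s => gauge_weight (u s) (v s) k) (dg k).
  by elim/ord3_ind: k => //; apply: is_derive_cst.
have g0 k : gauge_weight (u t) (v t) k != 0 by exact: gauge_weight_neq0.
have LE : liebr (M t) (diag3 0 (du / u t) (dv / v t)) i j =
    M t i j * (dg j / gauge_weight (u t) (v t) j - dg i / gauge_weight (u t) (v t) i).
  rewrite /dg /gauge_weight.
  elim/ord3_ind: i; elim/ord3_ind: j; rewrite !(mxE, sum_ord3) /=; field;
    by rewrite ?oner_neq0 ?ut0 ?vt0.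
pose f s := (gauge_weight (u s) (v s) i)^-1 * M s i j * gauge_weight (u s) (v s) j.
apply: (@near_eq_is_derive _ _ _ f).
  by near=> s; rewrite gaugeE //; near: s.
apply: (is_derive_eq (is_deriveM (is_deriveM (is_derive_inv (g0 i) (gd i))
  (Md i j)) (gd j))).
rewrite mxE LE mulrfctE /GRing.scale /=; field; by rewrite !g0.
Unshelve. all: by end_near. Qed.

Lemma derive1_quadratic (f : K -> K) (a b c x : K) :
    (forall z, f z = a * z ^+ 2 + b * z + c) ->
  derive1 (f : K^o -> K^o) x = 2%:R * a * x + b.
Proof.
move=> /funext->; rewrite derive1E.
have fP := is_deriveD (is_deriveD (is_deriveZ a (is_deriveX 1 (is_derive_id x 1)))
  (is_deriveZ b (is_derive_id x 1))) (is_derive_cst c x 1).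
by apply: etrans; [apply: derive_val | rewrite /GRing.scale /=; ring].
Qed.

End Derive.

Lemma is_derive_linear (K : numFieldType) (V W : normedModType K)
    (f : {linear V -> W}) (t w : V) :
  continuous f -> is_derive t w f (f w).
Proof.
move=> fC; have fD := @linear_differentiable _ _ _ f t fC.
by apply: DeriveDef; [exact: diff_derivable | rewrite deriveE // diff_lin].
Qed.

Lemma is_derive_fst (K : numFieldType) (V W : normedModType K) (t w : V * W) :
  is_derive t w fst w.1.
Proof. by apply: (@is_derive_linear _ _ _ fst) => s; exact: cvg_fst. Qed.

Lemma is_derive_snd (K : numFieldType) (V W : normedModType K) (t w : V * W) :
  is_derive t w snd w.2.
Proof. by apply: (@is_derive_linear _ _ _ snd) => s; exact: cvg_snd. Qed.

(** * Algebra of the Lax pair *)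

Section LaxPair.
Context {F : fieldType}.

Definition Ahat (theta2 theta3 q1 p1 q2 p2 t1 t2 x : F) : 'M[F]_3 :=
  x ^+ 2 *: Ahat3 + x *: Ahat2 p1 p2 + Ahat1 theta2 theta3 q1 p1 q2 p2 t1 t2.

(** The derivative of [Ahat] when [q1, p1, q2, p2] move with velocities
[dq1, dp1, dq2, dp2] and [t1, t2] stay fixed. *)
Definition Ahat_tangent (q1 p1 q2 p2 dq1 dp1 dq2 dp2 x : F) : 'M[F]_3 :=
  x *: mat3 0 0 0
            (- dp1) 0 0
            (- dp2) 0 0
  + mat3 (- dp1 - dp2) (- dq1) (- dq2)
         (dp1 * q1 + p1 * dq1) dp1 dp1
         (dp2 * q2 + p2 * dq2) dp2 dp2.

(** [Bhat1] for [(e1, e2, c) = (1, 0, 1 / (t1 - t2))] and [Bhat2] for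
[(0, 1, 1 / (t2 - t1))]; likewise for [Ham] below. *)
Definition Bhat (e1 e2 c theta2 theta3 q1 p1 q2 p2 : F) : 'M[F]_3 :=
  let X := Xaux theta2 q1 p1 q2 in
  let W := Waux theta3 q1 q2 p2 in
  mat3 0 (- e1) (- e2)
       (- (e1 * p1)) (- (c * W) + e1 * q1) (c * X)
       (- (e2 * p2)) (c * W) (- (c * X) + e2 * q2).

Definition Ham (e1 e2 c theta2 theta3 t1 t2 q1 p1 q2 p2 : F) : F :=
  e1 * HII (- theta2) t1 q1 p1 + e2 * HII (- theta3) t2 q2 p2 + p1 * p2
  + c * Xaux theta2 q1 p1 q2 * Waux theta3 q1 q2 p2.

Definition dHam_dp1 (e1 c theta3 t1 q1 p1 q2 p2 : F) : F :=
  e1 * (p1 *+ 2 - q1 ^+ 2 - t1) + p2 + c * (q1 - q2) * Waux theta3 q1 q2 p2.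
Definition dHam_dp2 (e2 c theta2 t2 q1 p1 q2 p2 : F) : F :=
  e2 * (p2 *+ 2 - q2 ^+ 2 - t2) + p1 + c * (q2 - q1) * Xaux theta2 q1 p1 q2.
Definition dHam_dq1 (e1 c theta2 theta3 q1 p1 q2 p2 : F) : F :=
  e1 * (theta2 - q1 * p1 *+ 2)
  + c * (p1 * Waux theta3 q1 q2 p2 - p2 * Xaux theta2 q1 p1 q2).
Definition dHam_dq2 (e2 c theta2 theta3 q1 p1 q2 p2 : F) : F :=
  e2 * (theta3 - q2 * p2 *+ 2)
  + c * (p2 * Xaux theta2 q1 p1 q2 - p1 * Waux theta3 q1 q2 p2).

Lemma Bhat1E (theta2 theta3 q1 p1 q2 p2 t1 t2 : F) :
  Bhat1 theta2 theta3 q1 p1 q2 p2 t1 t2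
  = Bhat 1 0 (t1 - t2)^-1 theta2 theta3 q1 p1 q2 p2.
Proof. by apply/matrixP; do 2!apply: ord3_ind; rewrite !mxE /=; ring. Qed.

Lemma Bhat2E (theta2 theta3 q1 p1 q2 p2 t1 t2 : F) :
  Bhat2 theta2 theta3 q1 p1 q2 p2 t1 t2
  = Bhat 0 1 (t2 - t1)^-1 theta2 theta3 q1 p1 q2 p2.
Proof. by apply/matrixP; do 2!apply: ord3_ind; rewrite !mxE /=; ring. Qed.

Lemma Ham1E (theta2 theta3 t1 t2 q1 p1 q2 p2 : F) :
  Ham1 theta2 theta3 t1 t2 q1 p1 q2 p2
  = Ham 1 0 (t1 - t2)^-1 theta2 theta3 t1 t2 q1 p1 q2 p2.
Proof. by rewrite /Ham1 /Ham mul1r mul0r addr0. Qed.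

Lemma Ham2E (theta2 theta3 t1 t2 q1 p1 q2 p2 : F) :
  Ham2 theta2 theta3 t1 t2 q1 p1 q2 p2
  = Ham 0 1 (t2 - t1)^-1 theta2 theta3 t1 t2 q1 p1 q2 p2.
Proof. by rewrite /Ham2 /Ham mul1r mul0r add0r. Qed.

(** The Hamiltonian vector field solves the zero-curvature equation: entrywise a
polynomial identity in all the variables, modulo [e1 ^ 2 = e1], [e2 = 1 - e1] and
[c (t1 - t2) = e1 - e2]. *)
Lemma zero_curvature_Hamiltonian_flow (e1 e2 c theta2 theta3 q1 p1 q2 p2 t1 t2 x : F) :
    e1 + e2 = 1 -> e1 * e2 = 0 -> c * (t1 - t2) = e1 - e2 ->
  Ahat_tangent q1 p1 q2 p2
     (dHam_dp1 e1 c theta3 t1 q1 p1 q2 p2)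
     (- dHam_dq1 e1 c theta2 theta3 q1 p1 q2 p2)
     (dHam_dp2 e2 c theta2 t2 q1 p1 q2 p2)
     (- dHam_dq2 e2 c theta2 theta3 q1 p1 q2 p2) x
  + liebr (Ahat theta2 theta3 q1 p1 q2 p2 t1 t2 x)
     (Bhat e1 e2 c theta2 theta3 q1 p1 q2 p2 - x *: diag3 0 e1 e2) = 0.
Proof.
move=> e1Pe2 e1Me2 ct.
have e2E : e2 = 1 - e1 by rewrite -e1Pe2 addrC addKr.
have e11 : e1 * e1 = e1 by rewrite -[RHS]mulr1 -e1Pe2 mulrDr e1Me2 addr0.
have {}ct : c * t1 = c * t2 + e1 - e2.
  by rewrite -addrA -ct mulrBr addrCA subrr addr0.
rewrite e2E in ct *.
apply/matrixP; do 2!apply: ord3_ind; rewrite !(mxE, sum_ord3) /=.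
all: rewrite /dHam_dp1 /dHam_dp2 /dHam_dq1 /dHam_dq2 /Xaux /Waux.
all: ring: ct e11.
Qed.

Lemma Ahat_tangentB (q1 p1 q2 p2 dq1 dp1 dq2 dp2 dq1' dp1' dq2' dp2' x : F) :
  Ahat_tangent q1 p1 q2 p2 (dq1 - dq1') (dp1 - dp1') (dq2 - dq2') (dp2 - dp2') x
  = Ahat_tangent q1 p1 q2 p2 dq1 dp1 dq2 dp2 x
    - Ahat_tangent q1 p1 q2 p2 dq1' dp1' dq2' dp2' x.
Proof. by apply/matrixP; do 2!apply: ord3_ind; rewrite !mxE /=; ring. Qed.

(** Uniqueness of the velocities.  The entry [(0, 1)] is [- dq1 - (x + q1) l2], so
its coefficient of [x] gives [l2] and then its constant term gives [dq1]; the entry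
[(0, 2)] gives [l3] and [dq2] in the same way.  Once [l2 = l3 = 0], the entries
[(1, 2)] and [(2, 1)] are [dp1] and [dp2]. *)
Lemma Ahat_gauge_tangent_inj (theta2 theta3 q1 p1 q2 p2 t1 t2 : F)
    (dq1 dp1 dq2 dp2 l2 l3 : F) :
  (forall x, Ahat_tangent q1 p1 q2 p2 dq1 dp1 dq2 dp2 x
     + liebr (Ahat theta2 theta3 q1 p1 q2 p2 t1 t2 x) (diag3 0 l2 l3) = 0) <->
  [/\ dq1 = 0, dp1 = 0, dq2 = 0, dp2 = 0 & l2 = 0 /\ l3 = 0].
Proof.
split=> [Z0|[-> -> -> -> [-> ->]] x]; last first.
  by apply/matrixP; do 2!apply: ord3_ind; rewrite !(mxE, sum_ord3) /=; ring.
have Zij x i j := congr1 (fun M : 'M[F]_3 => M i j) (Z0 x).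
have Z01 x : - dq1 - (x + q1) * l2 = 0.
  by have := Zij x 0 1; rewrite !(mxE, sum_ord3) /= => <-; ring.
have Z02 x : - dq2 - (x + q2) * l3 = 0.
  by have := Zij x 0 2%:R; rewrite !(mxE, sum_ord3) /= => <-; ring.
have l20 : l2 = 0.
  have -> : l2 = (- dq1 - (0 + q1) * l2) - (- dq1 - (1 + q1) * l2) by ring.
  by rewrite !Z01 subrr.
have l30 : l3 = 0.
  have -> : l3 = (- dq2 - (0 + q2) * l3) - (- dq2 - (1 + q2) * l3) by ring.
  by rewrite !Z02 subrr.
have dq10 : dq1 = 0.
  by have /eqP := Z01 0; rewrite l20 mulr0 subr0 oppr_eq0 => /eqP.
have dq20 : dq2 = 0.
  by have /eqP := Z02 0; rewrite l30 mulr0 subr0 oppr_eq0 => /eqP.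
split=> //.
  by have := Zij 0 1 2%:R; rewrite !(mxE, sum_ord3) /= l20 l30 => <-; ring.
by have := Zij 0 2%:R 1; rewrite !(mxE, sum_ord3) /= l20 l30 => <-; ring.
Qed.

Lemma liebrDr (L M N : 'M[F]_3) : liebr L (M + N) = liebr L M + liebr L N.
Proof. by rewrite /liebr mulmxDr mulmxDl opprD addrACA. Qed.

(** The equation is affine in the velocities: subtracting its instance at the
Hamiltonian vector field leaves the injective linear part. *)
Lemma zero_curvature_hat_iff (e1 e2 c theta2 theta3 q1 p1 q2 p2 t1 t2 : F)
    (dq1 dp1 dq2 dp2 l2 l3 : F) :
    e1 + e2 = 1 -> e1 * e2 = 0 -> c * (t1 - t2) = e1 - e2 ->
  (forall x, Ahat_tangent q1 p1 q2 p2 dq1 dp1 dq2 dp2 x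
     + liebr (Ahat theta2 theta3 q1 p1 q2 p2 t1 t2 x)
         (diag3 0 l2 l3
          + (Bhat e1 e2 c theta2 theta3 q1 p1 q2 p2 - x *: diag3 0 e1 e2)) = 0) <->
  [/\ dq1 = dHam_dp1 e1 c theta3 t1 q1 p1 q2 p2,
      dp1 = - dHam_dq1 e1 c theta2 theta3 q1 p1 q2 p2,
      dq2 = dHam_dp2 e2 c theta2 t2 q1 p1 q2 p2,
      dp2 = - dHam_dq2 e2 c theta2 theta3 q1 p1 q2 p2 & l2 = 0 /\ l3 = 0].
Proof.
move=> e1Pe2 e1Me2 ct.
set f1 := dHam_dp1 _ _ _ _ _ _ _ _; set g1 : F := (- dHam_dq1 _ _ _ _ _ _ _ _).
set f2 := dHam_dp2 _ _ _ _ _ _ _ _; set g2 : F := (- dHam_dq2 _ _ _ _ _ _ _ _).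
have Z x : Ahat_tangent q1 p1 q2 p2 dq1 dp1 dq2 dp2 x
     + liebr (Ahat theta2 theta3 q1 p1 q2 p2 t1 t2 x)
         (diag3 0 l2 l3
          + (Bhat e1 e2 c theta2 theta3 q1 p1 q2 p2 - x *: diag3 0 e1 e2))
   = Ahat_tangent q1 p1 q2 p2 (dq1 - f1) (dp1 - g1) (dq2 - f2) (dp2 - g2) x
     + liebr (Ahat theta2 theta3 q1 p1 q2 p2 t1 t2 x) (diag3 0 l2 l3).
  rewrite liebrDr Ahat_tangentB -[LHS]subr0.
  rewrite -(zero_curvature_Hamiltonian_flow theta2 theta3 q1 p1 q2 p2 x e1Pe2 e1Me2 ct).
  by rewrite addrA opprD addrACA subrr addr0 addrAC.
under eq_forall do rewrite Z.
rewrite Ahat_gauge_tangent_inj; split=> [[] | [-> -> -> -> ?]]; last by rewrite !subrr.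
by move=> /subr0_eq-> /subr0_eq-> /subr0_eq-> /subr0_eq->.
Qed.

End LaxPair.

(** * From partial derivatives to algebra *)

Section Flow.
Context {K : numFieldType} {V : normedModType K}.

(** The times occur in [Ahat] only through [- t1] and [- t2] on the diagonal, whence
the summand [- diag (0, dt1, dt2)]. *)
Lemma is_derive_Ahat (theta2 theta3 x : K) (q1 p1 q2 p2 t1 t2 : V -> K) (t w : V)
    (dq1 dp1 dq2 dp2 dt1 dt2 : K) :
    is_derive t w q1 dq1 -> is_derive t w p1 dp1 ->
    is_derive t w q2 dq2 -> is_derive t w p2 dp2 ->
    is_derive t w t1 dt1 -> is_derive t w t2 dt2 ->
  forall i j, is_derive t w
    (fun s => Ahat theta2 theta3 (q1 s) (p1 s) (q2 s) (p2 s) (t1 s) (t2 s) x i j)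
    ((Ahat_tangent (q1 t) (p1 t) (q2 t) (p2 t) dq1 dp1 dq2 dp2 x
      - diag3 0 dt1 dt2) i j).
Proof.
move=> dq1P dp1P dq2P dp2P dt1P dt2P.
(* Every entry is a constant, plus two multiples of functions, plus one product. *)
have entryP (f : V -> K) (df c a1 a2 : K) (f1 f2 f3 f4 : V -> K) (d1 d2 d3 d4 : K) :
    is_derive t w f1 d1 -> is_derive t w f2 d2 ->
    is_derive t w f3 d3 -> is_derive t w f4 d4 ->
    (forall s, f s = c + a1 * f1 s + a2 * f2 s + f3 s * f4 s) ->
    df = a1 * d1 + a2 * d2 + (f3 t * d4 + f4 t * d3) -> is_derive t w f df.
  move=> P1 P2 P3 P4 /funext-> ->.
  apply: (is_derive_eq (is_deriveD (is_deriveD (is_deriveD (is_derive_cst c t w)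
    (is_deriveZ a1 P1)) (is_deriveZ a2 P2)) (is_deriveM P3 P4))).
  by rewrite /GRing.scale /= add0r.
have cP := is_derive_cst (0 : K) t w.
do 2!apply: ord3_ind.
- by apply: (entryP _ _ 0 (-1) (-1) _ _ _ _ _ _ _ _ dp1P dp2P cP cP) => [s|];
    rewrite !mxE /=; ring.
- by apply: (entryP _ _ (-x) 0 (-1) _ _ _ _ _ _ _ _ cP dq1P cP cP) => [s|];
    rewrite !mxE /=; ring.
- by apply: (entryP _ _ (-x) 0 (-1) _ _ _ _ _ _ _ _ cP dq2P cP cP) => [s|];
    rewrite !mxE /=; ring.
- by apply: (entryP _ _ (- theta2) 0 (-x) _ _ _ _ _ _ _ _ cP dp1P dp1P dq1P) => [s|];
    rewrite !mxE /=; ring.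
- by apply: (entryP _ _ (- x ^+ 2) 1 (-1) _ _ _ _ _ _ _ _ dp1P dt1P cP cP) => [s|];
    rewrite !mxE /=; ring.
- by apply: (entryP _ _ 0 1 0 _ _ _ _ _ _ _ _ dp1P cP cP cP) => [s|];
    rewrite !mxE /=; ring.
- by apply: (entryP _ _ (- theta3) 0 (-x) _ _ _ _ _ _ _ _ cP dp2P dp2P dq2P) => [s|];
    rewrite !mxE /=; ring.
- by apply: (entryP _ _ 0 1 0 _ _ _ _ _ _ _ _ dp2P cP cP cP) => [s|];
    rewrite !mxE /=; ring.
- by apply: (entryP _ _ (- x ^+ 2) 1 (-1) _ _ _ _ _ _ _ _ dp2P dt2P cP cP) => [s|];
    rewrite !mxE /=; ring.
Qed.

Lemma derive1_B (e1 e2 x : K) (M : 'M[K]_3) :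
  derive1 (fun y : K => - (y *: diag3 0 e1 e2) + M) x = - diag3 0 e1 e2.
Proof.
rewrite derive1E.
have BP := is_deriveD
  (is_deriveN (is_derive_scale_cst (diag3 0 e1 e2) (is_derive_id x 1)))
  (is_derive_cst M x 1).
by apply: etrans; [apply: derive_val | rewrite scale1r addr0].
Qed.

(** Here the summand [- diag (0, e1, e2)] of the derivative of [Ahat] along the time
direction [(e1, e2)] cancels the derivative of [B] in [x]. *)
Lemma zero_curvature_gauge (theta2 theta3 x e1 e2 : K)
    (q1 p1 q2 p2 u v t1 t2 : V -> K) (t w : V)
    (dq1 dp1 dq2 dp2 du dv : K) (B : 'M[K]_3) :
    (\forall s \near t, u s != 0) -> (\forall s \near t, v s != 0) ->
    is_derive t w q1 dq1 -> is_derive t w p1 dp1 ->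
    is_derive t w q2 dq2 -> is_derive t w p2 dp2 ->
    is_derive t w u du -> is_derive t w v dv ->
    is_derive t w t1 e1 -> is_derive t w t2 e2 ->
  let A s := Amat theta2 theta3 (q1 s) (p1 s) (q2 s) (p2 s) (u s) (v s) (t1 s) (t2 s) x in
  let Bt y := - (y *: diag3 0 e1 e2) + gauge (u t) (v t) B in
  'D_w A t - derive1 (Bt : K -> _) x + liebr (A t) (Bt x)
  = gauge (u t) (v t)
      (Ahat_tangent (q1 t) (p1 t) (q2 t) (p2 t) dq1 dp1 dq2 dp2 x
       + liebr (Ahat theta2 theta3 (q1 t) (p1 t) (q2 t) (p2 t) (t1 t) (t2 t) x)
           (diag3 0 (du / u t) (dv / v t) + (B - x *: diag3 0 e1 e2))).
Proof.
move=> u0 v0 q1P p1P q2P p2P uP vP t1P t2P A Bt.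
have ut0 := nbhs_singleton u0; have vt0 := nbhs_singleton v0.
have AP := is_derive_gauge u0 v0 uP vP
  (is_derive_Ahat theta2 theta3 x q1P p1P q2P p2P t1P t2P).
have -> := @derive_val _ _ _ _ _ _ _ AP.
have BtE : Bt x = gauge (u t) (v t) (B - x *: diag3 0 e1 e2).
  rewrite gaugeD addrC; congr (_ + _).
  by rewrite /gauge mulmxN mulNmx -scalemxAr -scalemxAl -/(gauge _ _ _) gauge_diag3.
have AtE : A t = gauge (u t) (v t)
  (Ahat theta2 theta3 (q1 t) (p1 t) (q2 t) (p2 t) (t1 t) (t2 t) x) by [].
rewrite BtE AtE derive1_B // opprK -gauge_liebr //.
rewrite -[X in _ + X + _ = _](gauge_diag3 0 e1 e2 ut0 vt0) -!gaugeD liebrDr.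
by rewrite (addrAC _ _ (diag3 0 e1 e2)) subrK (addrA _ (liebr _ _)).
Qed.

(** [Ham] is quadratic in each of the four variables separately. *)
Lemma derive1_Ham_p1 (e1 e2 c theta2 theta3 t1 t2 q1 p1 q2 p2 : K) :
  derive1 (fun p : K^o => Ham e1 e2 c theta2 theta3 t1 t2 q1 p q2 p2 : K^o) p1
  = dHam_dp1 e1 c theta3 t1 q1 p1 q2 p2.
Proof.
rewrite (@derive1_quadratic _ _ e1
  (- (e1 * (q1 ^+ 2 + t1)) + p2 + c * (q1 - q2) * Waux theta3 q1 q2 p2)
  (Ham e1 e2 c theta2 theta3 t1 t2 q1 0 q2 p2)).
  by rewrite /dHam_dp1; ring.
by move=> z; rewrite /Ham /HII /Xaux; ring.
Qed.

Lemma derive1_Ham_p2 (e1 e2 c theta2 theta3 t1 t2 q1 p1 q2 p2 : K) :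
  derive1 (fun p : K^o => Ham e1 e2 c theta2 theta3 t1 t2 q1 p1 q2 p : K^o) p2
  = dHam_dp2 e2 c theta2 t2 q1 p1 q2 p2.
Proof.
rewrite (@derive1_quadratic _ _ e2
  (- (e2 * (q2 ^+ 2 + t2)) + p1 + c * (q2 - q1) * Xaux theta2 q1 p1 q2)
  (Ham e1 e2 c theta2 theta3 t1 t2 q1 p1 q2 0)).
  by rewrite /dHam_dp2; ring.
by move=> z; rewrite /Ham /HII /Waux; ring.
Qed.

Lemma derive1_Ham_q1 (e1 e2 c theta2 theta3 t1 t2 q1 p1 q2 p2 : K) :
  derive1 (fun q : K^o => Ham e1 e2 c theta2 theta3 t1 t2 q p1 q2 p2 : K^o) q1
  = dHam_dq1 e1 c theta2 theta3 q1 p1 q2 p2.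
Proof.
rewrite (@derive1_quadratic _ _ (- (e1 + c * p2) * p1)
  (e1 * theta2 + c * (p1 * Waux theta3 0 q2 p2 - p2 * Xaux theta2 0 p1 q2))
  (Ham e1 e2 c theta2 theta3 t1 t2 0 p1 q2 p2)).
  by rewrite /dHam_dq1 /Xaux /Waux; ring.
by move=> z; rewrite /Ham /HII /Xaux /Waux; ring.
Qed.

Lemma derive1_Ham_q2 (e1 e2 c theta2 theta3 t1 t2 q1 p1 q2 p2 : K) :
  derive1 (fun q : K^o => Ham e1 e2 c theta2 theta3 t1 t2 q1 p1 q p2 : K^o) q2
  = dHam_dq2 e2 c theta2 theta3 q1 p1 q2 p2.
Proof.
rewrite (@derive1_quadratic _ _ (- (e2 + c * p1) * p2)
  (e2 * theta3 + c * (p2 * Xaux theta2 q1 p1 0 - p1 * Waux theta3 q1 0 p2))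
  (Ham e1 e2 c theta2 theta3 t1 t2 q1 p1 0 p2)).
  by rewrite /dHam_dq2 /Xaux /Waux; ring.
by move=> z; rewrite /Ham /HII /Xaux /Waux; ring.
Qed.

Lemma zero_curvature_iff (e1 e2 c theta2 theta3 : K)
    (q1 p1 q2 p2 u v t1 t2 : V -> K) (t w : V) :
    e1 + e2 = 1 -> e1 * e2 = 0 -> c * (t1 t - t2 t) = e1 - e2 ->
    (\forall s \near t, u s != 0) -> (\forall s \near t, v s != 0) ->
    derivable q1 t w -> derivable p1 t w -> derivable q2 t w -> derivable p2 t w ->
    derivable u t w -> derivable v t w ->
    is_derive t w t1 e1 -> is_derive t w t2 e2 ->
  let A x s := Amat theta2 theta3 (q1 s) (p1 s) (q2 s) (p2 s) (u s) (v s)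
                 (t1 s) (t2 s) x in
  let B y := - (y *: diag3 0 e1 e2) + gauge (u t) (v t)
     (Bhat e1 e2 c theta2 theta3 (q1 t) (p1 t) (q2 t) (p2 t)) in
  (forall x, 'D_w (A x) t - derive1 (B : K -> _) x + liebr (A x t) (B x) = 0)
  <->
  [/\ 'D_w q1 t = dHam_dp1 e1 c theta3 (t1 t) (q1 t) (p1 t) (q2 t) (p2 t),
      'D_w p1 t = - dHam_dq1 e1 c theta2 theta3 (q1 t) (p1 t) (q2 t) (p2 t),
      'D_w q2 t = dHam_dp2 e2 c theta2 (t2 t) (q1 t) (p1 t) (q2 t) (p2 t),
      'D_w p2 t = - dHam_dq2 e2 c theta2 theta3 (q1 t) (p1 t) (q2 t) (p2 t) &
      'D_w u t = 0 /\ 'D_w v t = 0].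
Proof.
move=> e1Pe2 e1Me2 ct u0 v0 q1D p1D q2D p2D uD vD t1P t2P A B.
have ut0 := nbhs_singleton u0; have vt0 := nbhs_singleton v0.
have logD0 (f df : K) : f != 0 -> (df / f = 0) = (df = 0).
  move=> f0; apply/propext; split=> [/eqP|->]; last by rewrite mul0r.
  by rewrite mulf_eq0 invr_eq0 (negPf f0) orbF => /eqP.
rewrite -(logD0 _ ('D_w u t) ut0) -(logD0 _ ('D_w v t) vt0).
apply: iff_trans (zero_curvature_hat_iff _ _ _ _ _ _ _ _ _ _ _ _ e1Pe2 e1Me2 ct).
split=> Z x; last first.
  rewrite (zero_curvature_gauge _ _ _ _ u0 v0 (derivableP q1D) (derivableP p1D)
    (derivableP q2D) (derivableP p2D) (derivableP uD) (derivableP vD) t1P t2P).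
  by apply/(gauge_eq0 _ ut0 vt0); exact: Z.
apply/(gauge_eq0 _ ut0 vt0).
rewrite -(zero_curvature_gauge _ _ _ _ u0 v0 (derivableP q1D) (derivableP p1D)
    (derivableP q2D) (derivableP p2D) (derivableP uD) (derivableP vD) t1P t2P).
exact: Z.
Qed.

End Flow.

(** * The compatibility theorem *)

Theorem mainTheorem14 (R : realType) (theta1 theta2 theta3 : R[i])
    (D : set (CC2 R)) (q1 p1 q2 p2 u v : CC2 R -> CC R)
    (theta_sum : theta1 + theta2 + theta3 = 0)
    (D_domain : domain D)
    (D_offdiag : forall t, D t -> t.1 != t.2)
    (q1_hol : holomorphic_on D q1) (p1_hol : holomorphic_on D p1)
    (q2_hol : holomorphic_on D q2) (p2_hol : holomorphic_on D p2)
    (u_hol : holomorphic_on D u) (v_hol : holomorphic_on D v)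
    (u_neq0 : forall t, D t -> u t != 0) (v_neq0 : forall t, D t -> v t != 0) :
  let A (x : CC R) (t : CC2 R) : 'M[R[i]]_3 :=
    Amat theta2 theta3 (q1 t) (p1 t) (q2 t) (p2 t) (u t) (v t) t.1 t.2 x in
  let B1 (x : CC R) (t : CC2 R) : 'M[R[i]]_3 :=
    B1mat theta2 theta3 (q1 t) (p1 t) (q2 t) (p2 t) (u t) (v t) t.1 t.2 x in
  let B2 (x : CC R) (t : CC2 R) : 'M[R[i]]_3 :=
    B2mat theta2 theta3 (q1 t) (p1 t) (q2 t) (p2 t) (u t) (v t) t.1 t.2 x in
  (forall t, D t -> forall x : CC R,
     partial1 (A x) t - derive1 (fun y : CC R => B1 y t) x + liebr (A x t) (B1 x t) = 0
     /\
     partial2 (A x) t - derive1 (fun y : CC R => B2 y t) x + liebr (A x t) (B2 x t) = 0)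
  <->
  (forall t, D t ->
     [/\ hamilton_at partial1 (Ham1 theta2 theta3 t.1 t.2) q1 p1 q2 p2 t,
         hamilton_at partial2 (Ham2 theta2 theta3 t.1 t.2) q1 p1 q2 p2 t,
         partial1 u t = 0 /\ partial2 u t = 0 &
         partial1 v t = 0 /\ partial2 v t = 0]).
Proof.
move=> A B1 B2.
have nearD t (P : CC2 R -> Prop) :
    D t -> (forall s, D s -> P s) -> \forall s \near t, P s.
  move=> Dt DP; have [Dopen _ _] := D_domain.
  by apply: filterS DP _; exact: open_nbhs_nbhs.
have derD f t w : holomorphic_on D f -> D t -> derivable f t w.
  by move=> fD Dt; apply/diff_derivable/fD.
have flow (e1 e2 c : R[i]) (t w : CC2 R) :
    D t -> w = (e1, e2) -> e1 + e2 = 1 -> e1 * e2 = 0 ->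
    c * (t.1 - t.2) = e1 - e2 ->
    let B (y : CC R) : 'M[R[i]]_3 := - (y *: diag3 0 e1 e2) + gauge (u t) (v t)
      (Bhat e1 e2 c theta2 theta3 (q1 t) (p1 t) (q2 t) (p2 t)) in
    (forall x, 'D_w (A x) t - derive1 B x + liebr (A x t) (B x) = 0) <->
    hamilton_at (fun f => 'D_w f) (Ham e1 e2 c theta2 theta3 t.1 t.2)
      q1 p1 q2 p2 t /\ ('D_w u t = 0 /\ 'D_w v t = 0).
  move=> Dt -> e1Pe2 e1Me2 ct B.
  rewrite /hamilton_at.
  rewrite derive1_Ham_p1 derive1_Ham_p2 derive1_Ham_q1 derive1_Ham_q2.
  apply: (iff_trans (zero_curvature_iff theta2 theta3 e1Pe2 e1Me2 ct
    (nearD _ _ Dt u_neq0) (nearD _ _ Dt v_neq0)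
    (derD _ _ _ q1_hol Dt) (derD _ _ _ p1_hol Dt) (derD _ _ _ q2_hol Dt)
    (derD _ _ _ p2_hol Dt) (derD _ _ _ u_hol Dt) (derD _ _ _ v_hol Dt)
    (is_derive_fst t (e1, e2)) (is_derive_snd t (e1, e2)))).
  by split=> [[? ? ? ? ?]|[[? ? ? ?] ?]].
have flow1 t : D t -> (forall x : CC R,
     partial1 (A x) t - derive1 (fun y : CC R => B1 y t) x
     + liebr (A x t) (B1 x t) = 0) <->
   hamilton_at partial1 (Ham1 theta2 theta3 t.1 t.2) q1 p1 q2 p2 t /\
   (partial1 u t = 0 /\ partial1 v t = 0).
  move=> Dt; have t12 : t.1 - t.2 != 0 by rewrite subr_eq0 D_offdiag.
  have -> : Ham1 theta2 theta3 t.1 t.2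
      = Ham 1 0 (t.1 - t.2)^-1 theta2 theta3 t.1 t.2.
    by do 4!apply/funext => ?; exact: Ham1E.
  have B1E y : B1 y t = - (y *: diag3 0 1 0) + gauge (u t) (v t)
      (Bhat 1 0 (t.1 - t.2)^-1 theta2 theta3 (q1 t) (p1 t) (q2 t) (p2 t)).
    by rewrite /B1 /B1mat Bhat1E.
  under eq_fun do rewrite B1E.
  under eq_forall do rewrite B1E.
  apply: flow => //; [exact: addr0 | exact: mulr0 |].
  by rewrite mulVf // subr0.
have flow2 t : D t -> (forall x : CC R,
     partial2 (A x) t - derive1 (fun y : CC R => B2 y t) x
     + liebr (A x t) (B2 x t) = 0) <->
   hamilton_at partial2 (Ham2 theta2 theta3 t.1 t.2) q1 p1 q2 p2 t /\
   (partial2 u t = 0 /\ partial2 v t = 0).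
  move=> Dt; have t21 : t.2 - t.1 != 0 by rewrite subr_eq0 eq_sym D_offdiag.
  have -> : Ham2 theta2 theta3 t.1 t.2
      = Ham 0 1 (t.2 - t.1)^-1 theta2 theta3 t.1 t.2.
    by do 4!apply/funext => ?; exact: Ham2E.
  have B2E y : B2 y t = - (y *: diag3 0 0 1) + gauge (u t) (v t)
      (Bhat 0 1 (t.2 - t.1)^-1 theta2 theta3 (q1 t) (p1 t) (q2 t) (p2 t)).
    by rewrite /B2 /B2mat Bhat2E.
  under eq_fun do rewrite B2E.
  under eq_forall do rewrite B2E.
  apply: flow => //; [exact: add0r | exact: mul0r |].
  by rewrite -[t.1 - t.2]opprB mulrN mulVf // sub0r.
split=> H t Dt.
  have [|H1 [u1 v1]] := (flow1 t Dt).1; first by move=> x; have [] := H t Dt x.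
  have [|H2 [u2 v2]] := (flow2 t Dt).1; first by move=> x; have [] := H t Dt x.
  by split.
move=> x; have [H1 H2 [u1 u2] [v1 v2]] := H t Dt.
by split; [apply: (flow1 t Dt).2 | apply: (flow2 t Dt).2].
Qed.
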